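(* Let $X$ be a topological space and $p\in X$. Then Bob has a winning strategy in $\mathsf{G}_{\mathrm{bnd}}(\Omega_p,\Omega_p)$ if, and only if, there is an $m\in\mathbb{N}$ such that Bob has a winning strategy in $\mathsf{G}_m(\Omega_p,\Omega_p)$.
   Context: Here $\omega=\{0,1,2,\dots\}$ and $\mathbb{N}=\omega\setminus\{0\}$. For a topological space $X$ and $p\in X$, $\Omega_p=\{Y\subset X: p\in\overline{Y}\}$. Let $\mathcal{A},\mathcal{B}$ be families of sets. The following games are played between Alice and Bob, with innings $n\in\omega$; in each inning $n$ Alice first chooses $A_n\in\mathcal{A}$ and then Bob responds with a finite $B_n\subset A_n$, each player knowing all previous moves. In $\mathsf{G}_m(\mathcal{A},\mathcal{B})$ ($m\in\mathbb{N}$), Bob must choose $|B_n|\le m$ in every inning, and Bob wins if $\bigcup_{n\in\omega}B_n\in\mathcal{B}$; otherwise Alice wins. In $\mathsf{G}_{\mathrm{bnd}}(\mathcal{A},\mathcal{B})$, Bob wins if $\bigcup_{n\in\omega}B_n\in\mathcal{B}$ and there is a $k\in\omega$ such that $|B_n|\le k$ for every $n\in\omega$; otherwise Alice wins. *)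

(* Defs.v *)
From mathcomp Require Import all_boot all_order all_algebra all_classical topology.

Set Implicit Arguments.
Unset Strict Implicit.
Unset Printing Implicit Defensive.

Local Open Scope classical_set_scope.

Definition Omega (X : topologicalType) (p : X) : set (set X) :=
  [set Y | closure Y p].

(* A strategy for Bob sees the previous innings (A_0, B_0), ..., (A_(n-1), B_(n-1))
   and Alice's current move A_n.  It may return any set: that Bob's answers are
   legal is part of what makes the strategy winning. *)
Definition bob_strategy (T : Type) := seq (set T * set T) -> set T -> set T.

Definition follows (T : Type) (sigma : bob_strategy T) (A B : nat -> set T) :=
  forall n, B n = sigma (mkseq (fun i => (A i, B i)) n) (A n).

Definition legal_answer (T : Type) (A B : set T) := finite_set B /\ B `<=` A.

Definition winning_G (T : Type) (m : nat) (cA cB : set (set T))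
    (sigma : bob_strategy T) :=
  forall A B : nat -> set T, (forall n, cA (A n)) -> follows sigma A B ->
    (forall n, legal_answer (A n) (B n) /\ (B n #<= `I_m)%card) /\
    cB (\bigcup_n B n).

Definition winning_Gbnd (T : Type) (cA cB : set (set T))
    (sigma : bob_strategy T) :=
  forall A B : nat -> set T, (forall n, cA (A n)) -> follows sigma A B ->
    (forall n, legal_answer (A n) (B n)) /\
    cB (\bigcup_n B n) /\
    exists k : nat, forall n, (B n #<= `I_k)%card.

Definition bob_wins_G (T : Type) (m : nat) (cA cB : set (set T)) :=
  exists sigma : bob_strategy T, winning_G m cA cB sigma.

Definition bob_wins_Gbnd (T : Type) (cA cB : set (set T)) :=
  exists sigma : bob_strategy T, winning_Gbnd cA cB sigma.

(* Main.v *)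
Require Import Defs.
From mathcomp Require Import all_boot all_order all_algebra all_classical topology.

(** A strategy that wins the game G_m wins G_bnd, so only the other implication
    has content.  Let sigma win G_bnd.  Bob must be given one bound m that is
    known before the play starts, whereas sigma only promises a bound for each
    play separately.

    The bound becomes uniform after some position: if every position could be
    continued so that sigma answers with more than k points, for every k, then
    these continuations could be chained into a single infinite play with
    unbounded answers ([exists_chained_sequence]), which sigma does not allow.
    Hence there are a position la and a number k such that all answers of sigma
    after la have at most k points ([eventually_bounded]).  Bob then wants to
    play as if the game had already reached la.

    The difficulty is that the finite set of points selected on the way to la
    counts for sigma, but not for Bob.  It is harmless when p is not in its
    closure, because closure commutes with finite unions.  A finite set has p in
    its closure only if one of its points x satisfies closure [set x] p.
    Such a point wins the game by itself, so whenever Alice offers one, Bob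
    takes it and is done.  The simulation of sigma therefore only ever needs the
    moves of Alice that contain no such point; the position la is found in the
    game restricted to those moves ([evading]), where the points selected before
    la cannot matter. *)

Local Open Scope classical_set_scope.
Local Open Scope card_scope.

(** * Chaining finite extensions *)

(** Dependent choice for finite sequences: the extensions provided by the
    hypothesis are iterated, with k running through all the numbers.
    Extensions are nonempty so that the limit is an infinite sequence. *)
Lemma exists_chained_sequence (U : Type) (F : set U)
    (P : nat -> seq U -> Prop) :
  (forall k s, all [in F] s ->
     exists a t, all [in F] (a :: t) /\ P k (s ++ a :: t)) ->
  exists A : nat -> U, (forall n, F (A n)) /\
    forall k, exists n, P k (mkseq A n).
Proof.
move=> ext.
have [x0 _] := ext 0 [::] isT.
have /choice[g gP] : forall ks : nat * seq U, exists t, all [in F] ks.2 ->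
    [/\ all [in F] t, 0 < size t & P ks.1 (ks.2 ++ t)].
  move=> [k s] /=; case: (boolP (all [in F] s)) => [Fs|_]; last by exists [::].
  by have [a [t [Ft Pt]]] := ext k s Fs; exists (a :: t).
pose s_ := fix s_ n := if n is k.+1 then s_ k ++ g (k, s_ k) else [::].
have Fs n : all [in F] (s_ n).
  elim: n => //= n IH; have [Fg _ _] := gP (n, s_ n) IH.
  by rewrite all_cat IH.
have size_s n : n <= size (s_ n).
  elim: n => //= n IH; have [_ gt0 _] := gP (n, s_ n) (Fs n).
  by rewrite size_cat -addn1 leq_add.
have nth_s m d i : i < size (s_ m) -> nth x0 (s_ (d + m)) i = nth x0 (s_ m) i.
  move=> im; elim: d => //= d IH; rewrite nth_cat IH ifT //.
  elim: d {IH} => //= d IH.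
  by rewrite size_cat (leq_trans IH) // leq_addr.
pose A n := nth x0 (s_ n.+1) n.
have mkseqA k : mkseq A (size (s_ k)) = s_ k.
  apply: (@eq_from_nth _ x0); rewrite size_mkseq // => i ik.
  by rewrite nth_mkseq // /A -(nth_s _ k) // addnC nth_s.
exists A; split=> [n|k].
  by have := elimT (all_nthP x0) (Fs n.+1) n (size_s n.+1); rewrite inE.
exists (size (s_ k.+1)); rewrite mkseqA.
by have [_ _] := gP (k, s_ k) (Fs k).
Qed.

(** * Positions of a strategy *)

(** The information on which Bob acts when Alice has played la against sigma.
    Fixing sigma, a position is determined by the moves of Alice alone. *)
Definition history {T : Type} (sigma : bob_strategy T) (la : seq (set T)) :=
  foldl (fun h a => rcons h (a, sigma h a)) [::] la.

Definition reply {T : Type} (sigma : bob_strategy T) (la : seq (set T))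
    (a : set T) :=
  sigma (history sigma la) a.

Lemma follows_reply {T : Type} (sigma : bob_strategy T) (A : nat -> set T) :
  follows sigma A (fun n => reply sigma (mkseq A n) (A n)).
Proof.
move=> n; rewrite {1}/reply; congr sigma.
by elim: n => // n IH; rewrite !mkseqS -IH /history foldl_rcons.
Qed.

Lemma winning_Gbnd_reply {T : Type} (cA cB : set (set T))
    (sigma : bob_strategy T) (A : nat -> set T) :
    winning_Gbnd cA cB sigma -> (forall n, cA (A n)) ->
  [/\ forall n, legal_answer (A n) (reply sigma (mkseq A n) (A n)),
      cB (\bigcup_n reply sigma (mkseq A n) (A n)) &
      exists k : nat, forall n, reply sigma (mkseq A n) (A n) #<= `I_k].
Proof. by move=> win /win /(_ (follows_reply sigma A))[? []]. Qed.

Lemma eventually_bounded {T : Type} (F : set (set T)) (sigma : bob_strategy T) :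
    (forall A : nat -> set T, (forall n, F (A n)) ->
       exists k : nat, forall n, reply sigma (mkseq A n) (A n) #<= `I_k) ->
  exists la (k : nat), all [in F] la /\
    forall lb a, all [in F] lb -> F a -> reply sigma (la ++ lb) a #<= `I_k.
Proof.
move=> bnd; apply: contrapT => unb.
pose P k s := exists la a, s = rcons la a /\ ~ (reply sigma la a #<= `I_k).
have [|A [FA PA]] := @exists_chained_sequence _ F P.
  move=> k s Fs; apply: contrapT => noext; apply: unb; exists s, k; split=> //.
  move=> lb a Flb Fa; apply: contrapT => big; apply: noext.
  have Fr : all [in F] (rcons lb a) by rewrite all_rcons Flb andbT inE.
  have Pr : P k (s ++ rcons lb a) by exists (s ++ lb), a; rewrite rcons_cat.
  by case: (rcons lb a) (size_rcons lb a) Fr Pr => // b t _ Fr Pr; exists b, t.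
have [k Ak] := bnd A FA; have [n [la [a [E]]]] := PA k; case: n E => [|n].
  by case: la.
by rewrite mkseqS => /rcons_inj[<- <-].
Qed.

(** * Plays that start from a given position *)

Definition prepend {U : Type} (s : seq U) (A : nat -> U) (n : nat) :=
  nth (A (n - size s)) s n.

Lemma prependE {U : Type} (s : seq U) (A : nat -> U) n :
  prepend s A (size s + n) = A n.
Proof. by rewrite /prepend nth_default ?leq_addr// addKn. Qed.

Lemma mkseq_prepend {U : Type} (s : seq U) (A : nat -> U) n :
  mkseq (prepend s A) (size s + n) = s ++ mkseq A n.
Proof.
apply: (@eq_from_nth _ (A 0)); rewrite size_mkseq ?size_cat ?size_mkseq // => i.
move=> lt_i; rewrite nth_mkseq // nth_cat; case: ltnP => [lt_is|le_si].
  exact: set_nth_default.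
by rewrite /prepend nth_default // nth_mkseq // ltn_subLR.
Qed.

Lemma prepend_in {U : Type} (F : set U) (s : seq U) (A : nat -> U) :
  all [in F] s -> (forall n, F (A n)) -> forall n, F (prepend s A n).
Proof.
move=> Fs FA n; rewrite /prepend; case: (ltnP n (size s)) => [lt_n|le_n].
  by have := elimT (all_nthP (A (n - size s))) Fs n lt_n; rewrite inE.
by rewrite nth_default.
Qed.

(** Winning is a condition on infinite plays; it constrains the answer in a
    finite position because Alice can go on by repeating her last move. *)
Lemma legal_reply {T : Type} (cA cB : set (set T)) (sigma : bob_strategy T)
    (la : seq (set T)) (a : set T) :
    winning_Gbnd cA cB sigma -> all [in cA] la -> cA a ->
  legal_answer a (reply sigma la a).
Proof.
move=> win cAla cAa.
have [/(_ (size la + 0)) + _ _] := winning_Gbnd_reply _ _ _ _ win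
  (prepend_in _ _ (fun=> a) cAla (fun=> cAa)).
by rewrite mkseq_prepend prependE cats0.
Qed.

(** * Points that win by themselves *)

Lemma closure_finite_set {X : topologicalType} (p : X) (Y : set X) :
  finite_set Y -> closure Y p -> exists2 x, Y x & closure [set x] p.
Proof.
move=> /finite_seqP[s ->]; elim: s => [|x s IH].
  by rewrite set_nil closure0.
have -> : [set` x :: s] = [set x] `|` [set` s].
  apply/seteqP; split=> y /=; rewrite inE; first by move=> /predU1P.
  by move=> ?; apply/predU1P.
rewrite closureU => -[xp|/IH[y sy yp]]; first by exists x => //; left.
by exists y => //; right.
Qed.

(** The moves of Alice that offer Bob no immediate win. *)
Definition evading {X : topologicalType} (p : X) : set (set X) :=
  Omega p `&` [set A | forall x, A x -> ~ closure [set x] p].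

(** The answers of sigma after la win without those given on the way to la: what
    was selected there is a finite set without immediately winning points, so p
    is not in its closure. *)
Lemma Omega_tail {X : topologicalType} {p : X} {sigma : bob_strategy X}
    {la : seq (set X)} {A : nat -> set X} :
    winning_Gbnd (evading p) (Omega p) sigma ->
    all [in evading p] la -> (forall n, evading p (A n)) ->
  Omega p (\bigcup_n reply sigma (la ++ mkseq A n) (A n)).
Proof.
move=> win Ela EA; have EA' := prepend_in _ _ _ Ela EA.
have [legal + _] := winning_Gbnd_reply _ _ _ _ win EA'.
pose B n := reply sigma (mkseq (prepend la A) n) (prepend la A n).
set Y := (X in _ -> Omega p X).
have -> : \bigcup_n B n = \bigcup_(n in `I_(size la)) B n `|` Y.
  apply/seteqP; split=> [x [n _ Bx]|x [[n _ Bx]|[n _ Bx]]].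
  - case: (ltnP n (size la)) => [lt_n|/subnKC le_n]; first by left; exists n.
    right; exists (n - size la) => //.
    by move: Bx; rewrite /B -le_n mkseq_prepend prependE le_n.
  - by exists n.
  - by exists (size la + n) => //; rewrite /B mkseq_prepend prependE.
rewrite /Omega /= closureU => -[] //.
case/closure_finite_set => [|x [n _ Bx] xp].
  by apply: bigcup_finite => // n _; have [] := legal n.
by have [_ /(_ x)[]] := EA' n; first by have [_] := legal n; apply.
Qed.

Lemma bob_wins_G_of_Gbnd {X : topologicalType} (p : X) :
    bob_wins_Gbnd (Omega p) (Omega p) ->
  exists m : nat, 0 < m /\ bob_wins_G m (Omega p) (Omega p).
Proof.
move=> [sigma win].
have {}win : winning_Gbnd (evading p) (Omega p) sigma.
  by move=> A B EA; apply: win => n; have [] := EA n.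
have [A EA|la [k [Ela bnd]]] := eventually_bounded (evading p) sigma.
  by have [] := winning_Gbnd_reply _ _ _ _ win EA.
(* The summand 1 leaves room for an immediately winning point when k = 0. *)
exists k.+1; split=> //.
pose D := [set x | closure [set x] p].
(* Once Bob has secured the win he must still answer legally and within the
   bound. He goes on simulating sigma, on the history without the moves that
   are not evading, so that the simulated position stays one covered by bnd. *)
pose tau (h : seq (set X * set X)) a := if a \in evading p
  then reply sigma (la ++ [seq b <- unzip1 h | b \in evading p]) a
  else [set xget p (a `&` D)].
exists tau => A B OA fB.
have BE n : B n = if A n \in evading p
    then reply sigma (la ++ [seq b <- mkseq A n | b \in evading p]) (A n)
    else [set xget p (A n `&` D)].
  by rewrite fB /tau /unzip1 /mkseq -map_comp.
have hitP n : A n \notin evading p -> (A n `&` D) (xget p (A n `&` D)).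
  move=> /negP hit; apply: xgetPex; apply: contrapT => no.
  by apply: hit; rewrite inE; split=> // x Ax xp; apply: no; exists x.
split=> [n|].
  rewrite BE; case: ifPn => [|/hitP[Ax _]].
    rewrite inE => EAn.
    have Eh := filter_all [in evading p] (mkseq A n).
    split; first by apply: (legal_reply _ _ _ _ _ win); rewrite ?all_cat ?Ela.
    apply: (card_le_trans (bnd _ _ Eh EAn)).
    by apply: subset_card_le => i /= /ltnW.
  split; first by split; [exact: finite_set1 | move=> _ ->].
  rewrite (card_le_eql card_set1).
  by apply: subset_card_le => i /= /leq_trans; apply.
have [[n]|evade] := pselect (exists n, A n \notin evading p).
  move=> offer; have [Ax xp] := hitP n offer.
  by apply: closureS xp => _ ->; exists n => //; rewrite BE (negbTE offer).
have EA n : A n \in evading p.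
  by apply: contrapT => /negP ?; apply: evade; exists n.
have -> : \bigcup_n B n = \bigcup_n reply sigma (la ++ mkseq A n) (A n).
  apply: eq_bigcupr => n _; rewrite BE EA; congr (reply _ (_ ++ _) _).
  apply/all_filterP/(all_nthP set0) => i.
  by rewrite size_mkseq => ?; rewrite nth_mkseq.
by apply: (Omega_tail win) => // n; have := EA n; rewrite inE.
Qed.

Theorem theorem3p14 (X : topologicalType) (p : X) :
  bob_wins_Gbnd (Omega p) (Omega p) <->
  exists m : nat, (0 < m)%N /\ bob_wins_G m (Omega p) (Omega p).
Proof.
split=> [|[m [_ [sigma win]]]]; first exact: bob_wins_G_of_Gbnd.
exists sigma => A B OA /(win A B OA)[legal ?]; split=> [n|].
  by have [] := legal n.
by split=> //; exists m => n; have [] := legal n.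
Qed.
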